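(* Suppose $(\mathbf p,\mathbf q)\in\mathbb N^m\times\mathbb N^n$ with $\sum_i p_i=\sum_i q_i=c$, and let $a=\max_i p_i$, $b=\max_i q_i$. Let $T(\mathbf p,\mathbf q)$ be the time (number of machine operations) required by the Enumeration Algorithm (described in the context) to compute $N(\mathbf p,\mathbf q)$ or $M(\mathbf p,\mathbf q)$, after the binomial coefficients have been precomputed. Then, in either case: (1) $T(\mathbf p,\mathbf q)\le O\Big((ab+c)(\log c)^3\sum_{i=1}^m\binom{p_i+b-1}{b-1}\binom{p_i+\cdots+p_m+b-1}{b-1}\Big)$; (2) $T(\mathbf p,\mathbf q)\le O\big(m(ab+c)(a+b)^{b-1}(b+c)^{b-1}(\log c)^3\big)$; (3) $T(\mathbf p,\mathbf q)\le O\big(mn^{2b-1}(\log n)^3\big)$ for bounded $b$; (4) $T(\mathbf p,\mathbf q)\le O\big(mn^{b}(\log n)^3\big)$ for bounded $a,b$.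
   Context: Notation. $\mathbb N=\{0,1,2,\dots\}$; $\mathbb N^n$ is regarded as the sequences in $\mathbb N^\infty$ with all but the first $n$ components zero; $L$ is the left shift $L(r_1,r_2,\dots)=(r_2,r_3,\dots)$; $\mathbf r\backslash\mathbf s:=\mathbf r-\mathbf s+L\mathbf s$; $\binom{\mathbf r}{\mathbf s}:=\prod_i\binom{r_i}{s_i}$; $\mathbf r\le\mathbf s$ is componentwise; $\bar{\mathbf r}=(\bar r_1,\bar r_2,\dots)$ with $\bar r_i=\#\{j:r_j=i\}$ for $i\ge 1$; for $\mathbf s\in\mathbb N^d$, $C^{\mathbf s}(k)=\{\mathbf r\in\mathbb N^d:\sum_i r_i=k,\ \mathbf r\le\mathbf s\}$. $N(\mathbf p,\mathbf q)$ (resp. $M(\mathbf p,\mathbf q)$) is the number of $m\times n$ matrices with entries in $\{0,1\}$ (resp. in $\mathbb N$) with row sums $\mathbf p$ and column sums $\mathbf q$; these depend on $\mathbf q$ only through $\bar{\mathbf q}$, and $\bar N(\mathbf p,\bar{\mathbf q}):=N(\mathbf p,\mathbf q)$, $\bar M(\mathbf p,\bar{\mathbf q}):=M(\mathbf p,\mathbf q)$. Enumeration Algorithm. Input: $(\mathbf p,\bar{\mathbf q})$ with $\sum_i p_i=\sum_i q_i$. Output: $N(\mathbf p,\mathbf q)$ (or $M(\mathbf p,\mathbf q)$). A lookup table of cached results is kept, initialized with $\bar N(\mathbf 0,\mathbf 0)=1$ (or $\bar M(\mathbf 0,\mathbf 0)=1$). Steps: (i) if the value for the current argument is in the table, return it;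 (ii) in the binary case, if the Gale–Ryser condition shows $\bar N(\mathbf p,\bar{\mathbf q})=0$, cache and return $0$; (iii) otherwise evaluate the sum, with $\mathbf r=\bar{\mathbf q}$, $$\bar N(\mathbf p,\mathbf r)=\sum_{\mathbf s\in C^{\mathbf r}(p_1)}\binom{\mathbf r}{\mathbf s}\bar N(L\mathbf p,\mathbf r\backslash\mathbf s)\quad\text{or}\quad \bar M(\mathbf p,\mathbf r)=\sum_{\mathbf s:\,\mathbf s\in C^{\mathbf r+L\mathbf s}(p_1)}\binom{\mathbf r+L\mathbf s}{\mathbf s}\bar M(L\mathbf p,\mathbf r\backslash\mathbf s),$$ calling the algorithm recursively for each term; (iv) cache the result and return it. (Gale–Ryser: with $q_i'=\#\{j:q_j\ge i\}$ and $p_1\ge\cdots\ge p_m$, $N(\mathbf p,\mathbf q)\ne0$ iff $\sum_{i\le j}p_i\le\sum_{i\le j}q_i'$ for all $j<m$ and $\sum_{i\le m}p_i=\sum_{i\le m}q_i'$.) Cost model. All binomial coefficients $\binom{j}{k}$ with $j,k\le\#\{i:q_i>0\}$ have been precomputed and stored in a lookup table (an $O(n^3)$ step not counted in $T$). Because of caching, each distinct argument is evaluated only once, and $T(\mathbf p,\mathbf q)$ is the sum over distinct arguments of the time spent in the corresponding call excluding subcalls, i.e. the time to form each product $\binom{\mathbf r}{\mathbf s}$ (or $\binom{\mathbf r+L\mathbf s}{\mathbf s}$) from the stored binomials, to multiply it by the already known count, and to sum. Two integers of magnitude at most $k$ are multiplied in $O((\log k)(\log\log k)(\log\log\log k))$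 operations (Schönhage–Strassen). ''For bounded $b$'' (resp. ''bounded $a,b$'') means that the implied constant may depend on an upper bound for $b$ (resp. for $a$ and $b$). *)

(* Defs.v *)
From HB Require Import structures.
From mathcomp Require Import all_boot all_order all_algebra.
From mathcomp Require Import reals exp.
Set Implicit Arguments.
Unset Strict Implicit.
Unset Printing Implicit Defensive.
Import Order.TTheory GRing.Theory Num.Theory.

Local Open Scope nat_scope.

(* Ordinals start at 0, so the coordinate [i : 'I_d] of [r] is the component
   r_(i+1) of the sequence (r_1, r_2, ...). *)
Definition vec (d : nat) := {ffun 'I_d -> nat}.

Definition zero_vec (d : nat) : vec d := [ffun=> 0].

(* The sequence in N^oo obtained from [r] by padding with zeros. *)
Definition entry d (r : vec d) (k : nat) : nat :=
  if insub k is Some i then r i else 0.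

(* The left shift L. *)
Definition shift d (r : vec d) : vec d := [ffun i : 'I_d => entry r i.+1].

(* r \ s = r - s + L s.  Subtracting last keeps natural-number subtraction
   exact when s <= r + L s, which holds in both versions of the algorithm even
   if s <= r fails. *)
Definition residual d (r s : vec d) : vec d :=
  [ffun i => r i + shift s i - s i].

(* The vector \bar q of multiplicities of 1, ..., max q; it vanishes beyond. *)
Definition bar n (q : vec n) : vec (\max_i q i) :=
  [ffun i : 'I_(\max_i q i) => #|[set j | q j == i.+1]|].

(* [Binary] is the version counting N(p, q), [Natural] that counting M(p, q). *)
Inductive entries := Binary | Natural.

(* The vector r, resp. r + L s, which dominates s in the sum and occurs at the
   top of the binomial coefficients. *)
Definition top (v : entries) d (r s : vec d) : vec d :=
  match v with
  | Binary => r
  | Natural => [ffun i => r i + shift s i]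
  end.

(* C^u(k) *)
Definition bounded_comp d (u : vec d) (k : nat) : pred (vec d) :=
  fun s => (\sum_i s i == k) && [forall i, s i <= u i].

(* The index set of the sum, enumerated in a fixed order.  For r in N^d, every
   s in N^oo with s <= r + L s vanishes beyond d, so s in N^d is enough. *)
Definition summands (v : entries) d (r : vec d) (k : nat) : seq (vec d) :=
  [seq s <- [seq [ffun i => f i : nat] | f : {ffun 'I_d -> 'I_k.+1}]
     | bounded_comp (top v r s) k s].

Lemma mem_summands v d (r s : vec d) k :
  (s \in summands v r k) = bounded_comp (top v r s) k s.
Proof.
rewrite mem_filter; apply: andb_idr => /andP[/eqP sk _].
have sb i : s i < k.+1 by rewrite ltnS -sk (bigD1 i) //= leq_addr.
apply/imageP; exists [ffun i => Ordinal (sb i)] => //.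
by apply/ffunP => i; rewrite !ffunE.
Qed.

Lemma summands_uniq v d (r : vec d) k : uniq (summands v r k).
Proof.
apply: filter_uniq; rewrite map_inj_uniq ?enum_uniq // => f g /ffunP fg.
by apply/ffunP => i; apply: val_inj; have := fg i; rewrite !ffunE.
Qed.

(* The Gale-Ryser condition for N(p, q) <> 0, read off p and r = \bar q:
   q'_i = #{j : q_j >= i} is the sum of the r_k over k >= i. *)
Definition conjugate d (r : vec d) (i : nat) : nat :=
  \sum_(k : 'I_d | i <= k) r k.

Definition gale_ryser m d (p : vec m) (r : vec d) : bool :=
  let ps := sort geq (codom p) in
  [forall j : 'I_m,
     \sum_(0 <= i < j) nth 0 ps i <= \sum_(0 <= i < j) conjugate r i]
  && (\sum_(0 <= i < m) nth 0 ps i == \sum_(0 <= i < m) conjugate r i).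

Section Algorithm.

(* [mulT x y] and [addT x y] are the numbers of machine operations needed to
   multiply, resp. add, x and y. *)
Variables (mulT addT : nat -> nat -> nat) (v : entries) (m d : nat).

(* The lookup table of cached values, with the operations spent so far. *)
Record state := State {
  table : seq ((vec m * vec d) * nat);
  clock : nat }.

Definition tick (t : nat) (st : state) : state :=
  State (table st) (clock st + t).

Definition store (p : vec m) (r : vec d) (x : nat) (st : state) : state :=
  State (((p, r), x) :: table st) (clock st).

Definition lookup (p : vec m) (r : vec d) (st : state) : option nat :=
  ohead [seq e.2 | e <- table st & e.1 == (p, r)].

Definition timed_mul (x y : nat) (st : state) : nat * state :=
  (x * y, tick (mulT x y) st).

Definition timed_add (x y : nat) (st : state) : nat * state :=
  (x + y, tick (addT x y) st).

(* The product of the binomials 'C(u i, s i), each of them being stored. *)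
Definition timed_binom (u s : vec d) (st : state) : nat * state :=
  foldl (fun '(w, st) i => timed_mul w 'C(u i, s i) st) (1, st) (enum 'I_d).

(* Every recursive call shifts p, and [iter m shift p] is zero, so that with
   fuel m each branch reaches the initial entry (0, 0) of the table no later
   than it runs out of fuel, provided \sum_i p i = \sum_i i.+1 * r i. *)
Fixpoint enumerate (fuel : nat) (p : vec m) (r : vec d) (st : state)
    {struct fuel} : nat * state :=
  if lookup p r st is Some x then (x, st)
  else if (if v is Binary then ~~ gale_ryser p r else false) then
    (0, store p r 0 st)
  else if fuel is fuel'.+1 then
    let: (total, st') :=
      foldl (fun '(acc, st0) s =>
        let: (x, st1) := enumerate fuel' (shift p) (residual r s) st0 in
        let: (w, st2) := timed_binom (top v r s) s st1 in
        let: (y, st3) := timed_mul w x st2 in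
        timed_add acc y st3)
      (0, st) (summands v r (entry p 0)) in
    (total, store p r total st')
  else (0, st).

Definition initial_state : state :=
  State [:: ((zero_vec m, zero_vec d), 1)] 0.

End Algorithm.

(* T(p, q).  Only the operations on integers of the sums are timed. *)
Definition running_time (mulT addT : nat -> nat -> nat) (v : entries)
    m n (p : vec m) (q : vec n) : nat :=
  clock (enumerate mulT addT v m p (bar q) (initial_state m _)).2.

Local Open Scope ring_scope.

(* Operands of magnitude at most k are multiplied in
   O(log k loglog k logloglog k) operations. *)
Definition schonhage_strassen (R : realType) (mulT : nat -> nat -> nat) : Prop :=
  exists (C : R) (k0 : nat), forall k x y : nat,
    (k0 <= k)%N -> (x <= k)%N -> (y <= k)%N ->
    (mulT x y)%:R <= C * (ln k%:R * ln (ln k%:R) * ln (ln (ln k%:R))).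

(* Operands of magnitude at most k are added in O(log k) operations. *)
Definition linear_addition (R : realType) (addT : nat -> nat -> nat) : Prop :=
  exists (C : R) (k0 : nat), forall k x y : nat,
    (k0 <= k)%N -> (x <= k)%N -> (y <= k)%N ->
    (addT x y)%:R <= C * ln k%:R.

(* Main.v *)
(* Caching makes the running time a sum over distinct arguments (L^i p, r).
   Since r has weighted sum w = p_(i+1) + ... + p_m, the map
   r |-> (r_1, 2 r_2, ..., b r_b) embeds these r into the compositions of w, so
   level i has at most 'C(w + b - 1, b - 1) arguments; the sum evaluated for
   each of them ranges over at most 'C(p_(i+1) + b - 1, b - 1) vectors s.  If
   c <= N, the partial products of a binomial coefficient are at most (2N)^a and
   the counts at most (2N)^(2c), by crude bounds on both the number of summands
   and the binomials.  Hence the logarithms of the operands are O(a ln N) for the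
   b multiplications forming a product of binomials and O(c ln N) for the
   remaining operations, while their iterated logarithms are O(ln N). *)
Require Import Defs.
From HB Require Import structures.
From mathcomp Require Import all_boot all_order all_algebra.
From mathcomp Require Import reals sequences exp.
From mathcomp Require Import zify ring.
Set Implicit Arguments.
Unset Strict Implicit.
Unset Printing Implicit Defensive.
Import Order.TTheory GRing.Theory Num.Theory.

Local Open Scope nat_scope.

(** * Vectors and their numbers *)

Lemma bin_leq_exp n k : 'C(n, k) <= n ^ k.
Proof.
apply: leq_trans (_ : n ^_ k <= _).
  by rewrite -bin_ffact leq_pmulr ?fact_gt0.
elim: k n => [|k IH] n; first by rewrite ffactn0.
rewrite ffactnS expnS leq_mul2l (leq_trans (IH _)) ?orbT //.
by case: k {IH} => // k; rewrite leq_exp2r ?leq_pred.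
Qed.

Lemma entry_ord d (r : vec d) (i : 'I_d) : entry r i = r i.
Proof. by rewrite /entry valK. Qed.

Lemma entry_out d (r : vec d) k : d <= k -> entry r k = 0.
Proof. by move=> dk; rewrite /entry insubF // ltnNge dk. Qed.

Lemma entry_shift d (r : vec d) k : entry (shift r) k = entry r k.+1.
Proof.
case: (ltnP k d) => kd; last by rewrite !entry_out // ltnW.
by rewrite (entry_ord (shift r) (Ordinal kd)) ffunE.
Qed.

Lemma entry_iter_shift d (r : vec d) i k :
  entry (iter i (@shift d) r) k = entry r (i + k).
Proof. by elim: i k => // i IH k; rewrite iterS entry_shift IH addnS. Qed.

Lemma sum_entry d (r : vec d) (F : nat -> nat -> nat) :
  \sum_(i < d) F i (r i) = \sum_(0 <= i < d) F i (entry r i).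
Proof. by rewrite big_mkord; apply: eq_bigr => i _; rewrite entry_ord. Qed.

(** Both sides sum [F i (entry r i)]; [F i 0 = 0] removes the term that the shift pulls in from
    beyond the end. The varying [F] covers plain, truncated and weighted sums. *)
Lemma sum_shift_weighted d (r : vec d) (F : nat -> nat -> nat) :
  (forall i, F i 0 = 0) ->
  F 0 (entry r 0) + \sum_(i < d) F i.+1 (shift r i) = \sum_(i < d) F i (r i).
Proof.
move=> F0; rewrite (sum_entry (shift r) (fun i => F i.+1)) sum_entry.
under eq_big_nat do rewrite entry_shift.
case: d r => [|d] r; first by rewrite !big_geq ?entry_out ?F0.
rewrite big_nat_recr //= (entry_out r (leqnn d.+1)) F0 addn0.
by rewrite [RHS]big_nat_recl.
Qed.

Lemma sum_shift d (r : vec d) : entry r 0 + \sum_i shift r i = \sum_i r i.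
Proof. exact: (sum_shift_weighted r (F := fun _ x => x)). Qed.

Lemma sum_iter_shift d (r : vec d) k :
  \sum_i iter k (@shift d) r i = \sum_(j < d | k <= j) r j.
Proof.
elim: k r => [|k IH] r; first exact: eq_bigl.
rewrite iterSr IH.
have /= := sum_shift_weighted r (F := fun i x => if k < i then x else 0).
rewrite add0n => e; rewrite [RHS]big_mkcond -e; last by move=> i; case: ifP.
by rewrite [LHS]big_mkcond.
Qed.

(** Double counting: a positive [q j] is counted exactly once, at [k = q j - 1], with weight [q j];
    a zero [q j] is never counted. *)
Lemma bar_weight n (q : vec n) :
  \sum_(k < \max_i q i) k.+1 * bar q k = \sum_i q i.
Proof.
transitivity (\sum_(k < \max_i q i) \sum_j (if q j == k.+1 then k.+1 else 0)).
  apply: eq_bigr => k _; rewrite ffunE -sum1dep_card big_distrr /= big_mkcond.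
  by apply: eq_bigr => j _; rewrite muln1.
rewrite exchange_big; apply: eq_bigr => j _ /=.
case: (posnP (q j)) => [-> | q0]; first by rewrite big1.
have lt_q : (q j).-1 < \max_i q i by rewrite prednK // leq_bigmax.
rewrite (bigD1 (Ordinal lt_q)) //= prednK // eqxx big1 ?addn0 // => i.
by rewrite -val_eqE /= => ne; case: eqP => // e; rewrite e eqxx in ne.
Qed.

(** Stars and bars: the vectors embed into the tuples over ['I_k.+1] of sum [k], which
    [card_ord_partitions] counts. *)
Lemma size_uniq_comp d k (l : seq (vec d)) : 0 < d -> uniq l ->
  {in l, forall s : vec d, \sum_i s i = k} -> size l <= 'C(k + d - 1, d - 1).
Proof.
case: d l => // d l _ l_uniq l_sum.
rewrite addnS !subn1 /= addnC -card_ord_partitions.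
(* On [l] no entry exceeds [k], so [inord] never falls back to its default there. *)
pose f (s : vec d.+1) : d.+1.-tuple 'I_k.+1 := [tuple inord (s i) | i < d.+1].
have fE s i : s \in l -> tnth (f s) i = s i :> nat.
  move=> /l_sum sk; rewrite tnth_mktuple inordK // ltnS -sk.
  by rewrite (bigD1 i) //= leq_addr.
have f_inj : {in l &, injective f}.
  by move=> s t sl tl e; apply/ffunP=> i; rewrite -(fE _ _ sl) -(fE _ _ tl) e.
rewrite -(size_map f) cardE; apply: uniq_leq_size.
  by rewrite map_inj_in_uniq.
move=> _ /mapP[s sl ->]; rewrite mem_enum inE big_tuple -[eqbRHS](l_sum _ sl).
by apply/eqP/eq_bigr => i _; apply: fE.
Qed.

(** For [r = bar q] this is the sum of [q]. *)
Definition weight d (r : vec d) := \sum_(i < d) i.+1 * r i.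

(** No entry exceeds the weight, so restricting the entries to at most [w] loses no vector. *)
Definition weighted_vecs d w : seq (vec d) :=
  [seq r <- [seq [ffun i => f i : nat] | f : {ffun 'I_d -> 'I_w.+1}]
     | weight r == w].

Lemma mem_weighted_vecs d w (r : vec d) :
  (r \in weighted_vecs d w) = (weight r == w).
Proof.
rewrite mem_filter; apply: andb_idr => /eqP rw.
have rb i : r i < w.+1.
  rewrite ltnS -rw /weight (bigD1 i) //= mulSn -addnA leq_addr //.
apply/imageP; exists [ffun i => Ordinal (rb i)] => //.
by apply/ffunP => i; rewrite !ffunE.
Qed.

Lemma size_weighted_vecs d w :
  0 < d -> size (weighted_vecs d w) <= 'C(w + d - 1, d - 1).
Proof.
move=> d0; pose f (r : vec d) : vec d := [ffun i : 'I_d => i.+1 * r i].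
have f_inj : injective f.
  move=> r s /ffunP e; apply/ffunP=> i; have := e i; rewrite !ffunE.
  by move/eqP; rewrite eqn_pmul2l // => /eqP.
rewrite -(size_map f); apply: size_uniq_comp => //.
  rewrite map_inj_uniq // filter_uniq // map_inj_uniq ?enum_uniq //.
  move=> g h /ffunP e; apply/ffunP=> i; apply: val_inj.
  by have := e i; rewrite !ffunE.
move=> _ /mapP[r rw ->]; move: rw; rewrite mem_weighted_vecs => /eqP <-.
by apply: eq_bigr => i _; rewrite ffunE.
Qed.

(** The shift lowers every index by one, so [s] outweighs [shift s] by exactly the sum of [s]. Hence
    a recursive call keeps the weight of [r] equal to the sum of what remains of [p]. *)
Lemma weight_residual d (r s : vec d) : (forall i, s i <= r i + shift s i) ->
  weight (residual r s) + \sum_i s i = weight r.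
Proof.
move=> sr; rewrite /weight.
have := sum_shift_weighted s (F := fun i x => i * x) (fun i => muln0 i).
rewrite mul0n add0n => e.
apply/eqP; rewrite -(eqn_add2r (\sum_(i < d) i * s i)) -{2}e -addnA.
rewrite -big_split -!big_split /=; apply/eqP/eq_bigr => i _.
by rewrite ffunE -mulSn -!mulnDr subnK.
Qed.

(** By symmetry the binomial is ['C(k + d - 1, k)]. The exponent [k], in place of [d - 1], lets the
    bounds of successive levels multiply to a power whose exponent is the sum of [p]. *)
Lemma bin_sub1_leq k d N : 0 < d <= N -> 'C(k + d - 1, d - 1) <= (k + N) ^ k.
Proof.
case/andP=> d0 dN; rewrite -addnBA // -bin_sub ?leq_addl // addnK.
case: k => [|k]; first by rewrite bin0.
apply: leq_trans (bin_leq_exp _ _) _.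
by rewrite leq_exp2r // leq_add2l (leq_trans (leq_subr _ _)).
Qed.

Lemma size_summands v d (r : vec d) k :
  0 < d -> size (summands v r k) <= 'C(k + d - 1, d - 1).
Proof.
move=> d0; apply: size_uniq_comp (summands_uniq _ _ _) _ => // s.
by rewrite mem_summands => /andP[/eqP].
Qed.

Lemma bounded_comp_residual v d (r s : vec d) k :
  bounded_comp (top v r s) k s -> forall i, s i <= r i + shift s i.
Proof.
case/andP=> _ /forallP le_s i; have := le_s i.
case: v {le_s} => /=; rewrite ?ffunE // => /leq_trans.
by apply; apply: leq_addr.
Qed.

Lemma shift_leq_sum d (s : vec d) i : shift s i <= \sum_j s j.
Proof. by rewrite -sum_shift (bigD1 i) //= addnCA leq_addr. Qed.

Lemma leq_weight d (r : vec d) i : r i <= weight r.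
Proof. by rewrite /weight (bigD1 i) //= mulSn -addnA leq_addr. Qed.

Lemma top_leq v d (r s : vec d) i : top v r s i <= weight r + \sum_j s j.
Proof.
have r_le := leq_weight r i; have s_le := shift_leq_sum s i.
case: v => /=; last by rewrite ffunE leq_add.
exact: leq_trans r_le (leq_addr _ _).
Qed.

(** * Operation count of the cached recursion *)

Definition cached m d (st : state m d) (p : vec m) (r : vec d) : bool :=
  (p, r) \in map fst (table st).

Lemma lookup_mem m d (st : state m d) p r x :
  lookup p r st = Some x -> ((p, r), x) \in table st.
Proof.
rewrite /lookup; case e: [seq _ | _ <- _ & _] => [|y l] //= [<-].
have: y \in y :: l by rewrite mem_head.
rewrite -e => /mapP[[kr z]]; rewrite mem_filter /= => /andP[/eqP-> ] + ->.
by [].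
Qed.

Lemma lookup_cached m d (st : state m d) p r :
  lookup p r st = None -> ~~ cached st p r.
Proof.
rewrite /lookup /cached => e; apply/mapP => -[[kr z]] /= ez ek.
have: z \in [seq e.2 | e <- table st & e.1 == (p, r)].
  by apply/mapP; exists (kr, z); rewrite // mem_filter /= ez -ek eqxx.
by case: [seq _ | _ <- _ & _] e.
Qed.

Section Cost.

(** [Y] bounds the tops of all binomials, [tb] the cost of a multiplication inside a product of
    binomials, and [tc] that of every other operation. *)
Variables (mulT addT : nat -> nat -> nat) (v : entries) (m d c a Y tb tc : nat).
Hypothesis d_gt0 : 0 < d.
Hypothesis d_le_c : d <= c.
Hypothesis cY : c + c <= Y.
Hypothesis small_mul :
  forall x y, x <= Y ^ a -> y <= Y ^ a -> mulT x y <= tb.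
Hypothesis big_mul :
  forall x y, x <= (Y * Y) ^ c -> y <= (Y * Y) ^ c -> mulT x y <= tc.
Hypothesis big_add :
  forall x y, x <= (Y * Y) ^ c -> y <= (Y * Y) ^ c -> addT x y <= tc.

Let summand_cost := d * tb + tc + tc.

(** Per unit of [p], one factor [Y] accounts for the number of summands and the other for the
    product of binomials. *)
Definition bounded_table (st : state m d) :=
  forall p r x, ((p, r), x) \in table st -> x <= (Y * Y) ^ (\sum_i p i).

Definition uncached (st : state m d) (p : vec m) : nat :=
  count (fun r => ~~ cached st p r) (weighted_vecs d (\sum_i p i)).

Definition call_cost (p : vec m) : nat :=
  'C(entry p 0 + d - 1, d - 1) * summand_cost.

(* The cost of evaluating all uncached arguments reachable from [p]: a call
   never increases the sum of the clock and of this potential. *)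
Definition potential fuel (p : vec m) (st : state m d) : nat :=
  \sum_(i < fuel) call_cost (iter i (@shift m) p)
                  * uncached st (iter i (@shift m) p).

Lemma potentialS fuel p st : potential fuel.+1 p st =
  call_cost p * uncached st p + potential fuel (shift p) st.
Proof.
rewrite /potential big_ord_recl; congr (_ + _).
by apply: eq_bigr => i _; rewrite -iterSr.
Qed.

Definition cache_le (st st' : state m d) :=
  forall p r, cached st p r -> cached st' p r.

Lemma uncached_mono st st' p :
  cache_le st st' -> uncached st' p <= uncached st p.
Proof. by move=> le; apply: sub_count => r; apply/contra/le. Qed.

Lemma potential_mono fuel p st st' :
  cache_le st st' -> potential fuel p st' <= potential fuel p st.
Proof.
by move=> le; apply: leq_sum => i _; rewrite leq_mul2l uncached_mono ?orbT.
Qed.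

Lemma cached_store (p : vec m) (r : vec d) x (st : state m d) p' r' :
  cached (store p r x st) p' r' = ((p', r') == (p, r)) || cached st p' r'.
Proof. by []. Qed.

Lemma cache_le_store (p : vec m) (r : vec d) x (st : state m d) :
  cache_le st (store p r x st).
Proof. by move=> p' r' h; rewrite cached_store h orbT. Qed.

Lemma uncached_store (p : vec m) (r : vec d) x (st : state m d) :
  weight r = \sum_i p i -> ~~ cached st p r ->
  uncached (store p r x st) p < uncached st p.
Proof.
move=> rp nc; rewrite /uncached.
have rin : r \in weighted_vecs d (\sum_i p i) by rewrite mem_weighted_vecs rp.
(* One occurrence of [r] is split off: it turns from uncached to cached, and the rest cannot gain
   uncached vectors. *)
have /permP perm_r := perm_to_rem rin; rewrite !perm_r /= nc cached_store eqxx /=.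
by rewrite add0n add1n ltnS; apply/sub_count => s; apply/contra/cache_le_store.
Qed.

Lemma bounded_table_store (p : vec m) (r : vec d) x (st : state m d) :
  bounded_table st -> x <= (Y * Y) ^ (\sum_i p i) -> bounded_table (store p r x st).
Proof.
by move=> bt xle p' r' x'; rewrite inE => /predU1P[[-> _ ->] //|]; apply: bt.
Qed.

(** A partial product is at most [Y ^ e], where [e] is the sum of the entries of [s] already
    treated. As [e <= k <= a], every multiplication costs at most [tb]. *)
Lemma timed_binom_spec k (u s : vec d) (st : state m d) :
  0 < Y -> (forall i, u i <= Y) -> \sum_i s i = k -> k <= a ->
  let: (w, st') := timed_binom mulT u s st in
  [/\ w <= Y ^ k, table st' = table st & clock st' <= clock st + d * tb].
Proof.
move=> Y_gt0 uY sk ka; rewrite /timed_binom.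
have -> : d * tb = size (enum 'I_d) * tb by rewrite -cardE card_ord.
suff spec l w e (st0 : state m d) : e + \sum_(i <- l) s i = k -> w <= Y ^ e ->
    let: (w', st') :=
      foldl (fun '(w, st) i => timed_mul mulT w 'C(u i, s i) st) (w, st0) l in
    [/\ w' <= Y ^ k, table st' = table st0
      & clock st' <= clock st0 + size l * tb].
  by apply: (spec _ 1 0); rewrite // big_enum.
elim: l w e st0 => [|i l IH] w e st0 sk' we /=.
  by rewrite -sk' big_nil addn0; split; rewrite ?leq_addr.
have se : e + s i + \sum_(j <- l) s j = k by rewrite -sk' big_cons addnA.
have Ci : 'C(u i, s i) <= Y ^ s i.
  apply: leq_trans (bin_leq_exp _ _) _.
  by case: (s i) => // n; rewrite leq_exp2r.
have Ya j : j <= k -> Y ^ j <= Y ^ a.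
  by move=> jk; rewrite leq_pexp2l // (leq_trans jk).
have wle : w * 'C(u i, s i) <= Y ^ (e + s i) by rewrite expnD leq_mul.
have := IH _ _ (tick (mulT w 'C(u i, s i)) st0) se wle.
case: foldl => w' st' [w'le tst cst]; split=> //.
apply: leq_trans cst _; rewrite /= mulSn addnA leq_add2r leq_add2l.
apply: small_mul; first by rewrite (leq_trans we) ?Ya // -se -addnA leq_addr.
by rewrite (leq_trans Ci) ?Ya // -se addnAC leq_addl.
Qed.

(** Induction on the fuel. Storing a new argument lowers the potential at the level of [p] by at
    least [call_cost p], which pays for the sum evaluated there; the subcalls are paid from the
    deeper levels. *)
Lemma enumerate_spec fuel (p : vec m) (r : vec d) (st : state m d) :
  0 < a -> weight r = \sum_i p i -> \sum_i p i <= c -> (forall i, p i <= a) ->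
  bounded_table st ->
  let: (x, st') := enumerate mulT addT v fuel p r st in
  [/\ x <= (Y * Y) ^ (\sum_i p i), bounded_table st', cache_le st st'
    & clock st' + potential fuel p st' <= clock st + potential fuel p st].
Proof.
move=> a_gt0; elim: fuel p r st => [|fuel IH] p r st rp pc pa bt /=;
  case e: (lookup p r st) => [x|]; try by split=> //; apply/bt/lookup_mem/e.
  case: ifP => _; split=> //.
  - exact: bounded_table_store.
  - exact: cache_le_store.
  - by rewrite leq_add2l potential_mono //; apply: cache_le_store.
have nc := lookup_cached e.
case: ifP => _.
  split=> //.
  - exact: bounded_table_store.
  - exact: cache_le_store.
  - by rewrite leq_add2l potential_mono //; apply: cache_le_store.
set k := entry p 0.
have sum_p : k + \sum_i shift p i = \sum_i p i by apply: sum_shift.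
have k_le_c : k <= c by rewrite (leq_trans _ pc) // -sum_p leq_addr.
have k_le_a : k <= a.
  by rewrite /k /entry; case: insub.
have Y_gt0 : 0 < Y by rewrite (leq_trans _ cY) // addn_gt0 (leq_trans d_gt0).
have YY_gt0 : 0 < Y * Y by rewrite muln_gt0 Y_gt0.
have shift_pa i : shift p i <= a.
  by rewrite ffunE /entry; case: insub.
(* [Z] bounds a single term: a product of binomials times a count one level below. There are at most
   [(k + c) ^ k <= Y ^ k] terms. *)
set Z := Y ^ k * (Y * Y) ^ (\sum_i shift p i).
have Zle : size (summands v r k) * Z <= (Y * Y) ^ (\sum_i p i).
  rewrite -sum_p expnD [in leqRHS]expnMn -mulnA leq_mul2r.
  apply/orP; right; apply: leq_trans (size_summands _ _ _ d_gt0) _.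
  apply: leq_trans (bin_sub1_leq k (N := c) _) _; first by rewrite d_gt0.
  case: k {Z sum_p k_le_a} k_le_c => // k kc.
  by rewrite leq_exp2r // (leq_trans _ cY) // leq_add2r.
have valY x : x <= (Y * Y) ^ (\sum_i p i) -> x <= (Y * Y) ^ c.
  by move/leq_trans; apply; rewrite leq_pexp2l.
(* The budget [acc + size l * Z] never grows, since each term moves at most [Z] into [acc]; so all
   partial sums obey the bound on the final count. *)
have fold_spec l acc st0 : {in l, forall s, bounded_comp (top v r s) k s} ->
    acc + size l * Z <= (Y * Y) ^ (\sum_i p i) -> bounded_table st0 ->
    let: (total, st') :=
      foldl (fun '(acc, st0) s =>
        let: (x, st1) :=
          enumerate mulT addT v fuel (shift p) (residual r s) st0 in
        let: (w, st2) := timed_binom mulT (top v r s) s st1 in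
        let: (y, st3) := timed_mul mulT w x st2 in
        timed_add addT acc y st3) (acc, st0) l in
    [/\ total <= (Y * Y) ^ (\sum_i p i), bounded_table st', cache_le st0 st'
      & clock st' + potential fuel (shift p) st' <=
          clock st0 + potential fuel (shift p) st0 + size l * summand_cost].
  elim: l acc st0 => [|s l IHl] acc st0 sl accZ bt0 /=.
    by rewrite !addn0 in accZ *; split.
  have sB : bounded_comp (top v r s) k s by rewrite sl ?mem_head.
  have sum_s : \sum_i s i = k by case/andP: sB => /eqP.
  have res_w : weight (residual r s) = \sum_i shift p i.
    apply/eqP; rewrite -(eqn_add2l k) sum_p -rp addnC -{1}sum_s.
    by rewrite weight_residual //; apply: bounded_comp_residual sB.
  have sum_shift_c : \sum_i shift p i <= c.
    by rewrite (leq_trans _ pc) // -sum_p leq_addl.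
  have := IH _ _ st0 res_w sum_shift_c shift_pa bt0.
  case: enumerate => x st1 [xle bt1 le1 clock1].
  have topY i : top v r s i <= Y.
    rewrite (leq_trans (top_leq _ _ _ _)) // sum_s rp.
    by rewrite (leq_trans _ cY) // leq_add.
  have := timed_binom_spec st1 Y_gt0 topY sum_s k_le_a.
  case: timed_binom => w st2 [wle tab2 clock2] /=.
  have yle : w * x <= Z by rewrite leq_mul.
  have Z_le : Z <= (Y * Y) ^ (\sum_i p i).
    by rewrite (leq_trans _ accZ) //= mulSn addnCA leq_addr.
  have accle : acc <= (Y * Y) ^ (\sum_i p i).
    by rewrite (leq_trans _ accZ) // leq_addr.
  have sl' : {in l, forall s, bounded_comp (top v r s) k s}.
    by move=> t tl; rewrite sl // inE tl orbT.
  have accZ' : acc + w * x + size l * Z <= (Y * Y) ^ (\sum_i p i).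
    by apply: leq_trans accZ; rewrite /= mulSn addnA leq_add2r leq_add2l.
  rewrite [timed_add _ acc _ _]/timed_add; set st4 := tick (addT acc _) _.
  have bt4 : bounded_table st4 by move=> ? ? ?; rewrite /= tab2; apply: bt1.
  have le4 : cache_le st0 st4 by move=> ? ? /le1; rewrite /cached /= tab2.
  have := IHl (acc + w * x) st4 sl' accZ' bt4.
  rewrite /=; case: foldl => total st' [totle bt' le' clock']; split=> //.
    by move=> ? ? /le4/le'.
  apply: leq_trans clock' _.
  have -> : potential fuel (shift p) st4 = potential fuel (shift p) st1.
    by rewrite /potential /uncached /cached /= tab2.
  have w_le : w <= (Y * Y) ^ c.
    apply/valY/(leq_trans wle)/(leq_trans _ Z_le).
    by rewrite /Z leq_pmulr // expn_gt0 YY_gt0.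
  have x_le : x <= (Y * Y) ^ c.
    by rewrite (leq_trans xle) // leq_pexp2l.
  have := big_mul w_le x_le.
  have := big_add (valY _ accle) (valY _ (leq_trans yle Z_le)).
  rewrite /= mulSn /summand_cost; lia.
have sl : {in summands v r k, forall s, bounded_comp (top v r s) k s}.
  by move=> s; rewrite mem_summands.
have := fold_spec _ 0 st sl Zle bt.
case: foldl => total st' [totle bt' le' clock']; split.
- by [].
- exact: bounded_table_store.
- by move=> ? ? /le'; apply: cache_le_store.
(* Comparing with [st] rather than with [st'] avoids showing that the recursive
   calls do not cache [(p, r)] themselves. *)
have unc : call_cost p * (uncached (store p r total st') p).+1 <=
    call_cost p * uncached st p.
  rewrite leq_mul2l; apply/orP; right.
  apply: leq_ltn_trans (uncached_store 0 rp nc).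
  apply: uncached_mono => p' r'; rewrite !cached_store.
  by case: eqP => //= _ /le'.
have pot : potential fuel (shift p) (store p r total st') <=
    potential fuel (shift p) st'.
  by apply: potential_mono; apply: cache_le_store.
have size_le : size (summands v r k) * summand_cost <= call_cost p.
  by rewrite leq_mul2r size_summands ?orbT.
rewrite /= !potentialS; rewrite mulnS in unc.
move: (potential fuel _ _) (potential fuel _ (store _ _ _ _))
  (call_cost p * uncached (store _ _ _ _) _) clock' pot size_le unc.
by move: (call_cost p) (_ * summand_cost) (_ * uncached _ _); lia.
Qed.

End Cost.

(** * Running time in terms of the unit costs *)

Lemma max_leq_sum n (q : vec n) : \max_i q i <= \sum_i q i.
Proof. by apply/bigmax_leqP => i _; rewrite (bigD1 i) //= leq_addr. Qed.

Lemma max_gt0 n (q : vec n) : 0 < \sum_i q i -> 0 < \max_i q i.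
Proof.
rewrite !lt0n; apply: contra => /eqP q0; rewrite big1 // => i _.
by apply/eqP; rewrite -leqn0 -q0 leq_bigmax.
Qed.

(** Both arguments are then zero, and the initial table answers at once. *)
Lemma running_time0 mulT addT v m n (p : vec m) (q : vec n) :
  \sum_i p i = 0 -> \sum_i q i = 0 -> running_time mulT addT v p q = 0.
Proof.
move=> p0 q0; rewrite /running_time.
have -> : p = zero_vec m.
  apply/ffunP => i; rewrite ffunE; apply/eqP.
  by rewrite -leqn0 -p0 (bigD1 i) ?leq_addr.
have -> : bar q = zero_vec _.
  apply/ffunP => i; rewrite [RHS]ffunE; apply/eqP; rewrite -leqn0.
  by rewrite -[leqRHS]q0 -(bar_weight q) leq_weight.
by case: m {p p0} => [|m]; rewrite /= /lookup /= eqxx.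
Qed.

(** The clock starts at 0, so the initial potential bounds the total time. At each level the
    uncached arguments are at most all vectors of the right weight. *)
Lemma running_time_leq mulT addT v m n (p : vec m) (q : vec n) Y tb tc :
  let c := \sum_i p i in
  let a := \max_i p i in
  let b := \max_i q i in
  0 < c -> \sum_i q i = c -> c + c <= Y ->
  (forall x y, x <= Y ^ a -> y <= Y ^ a -> mulT x y <= tb) ->
  (forall x y, x <= (Y * Y) ^ c -> y <= (Y * Y) ^ c -> mulT x y <= tc) ->
  (forall x y, x <= (Y * Y) ^ c -> y <= (Y * Y) ^ c -> addT x y <= tc) ->
  running_time mulT addT v p q <=
    (\sum_(i < m) 'C(p i + b - 1, b - 1) *
       'C((\sum_(j < m | i <= j) p j) + b - 1, b - 1)) * (b * tb + tc + tc).
Proof.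
move=> c a b c_gt0 qc cY small_mul big_mul big_add.
have b_gt0 : 0 < b by apply: max_gt0; rewrite qc.
have b_le_c : b <= c by rewrite -qc max_leq_sum.
have a_gt0 : 0 < a by apply: max_gt0.
have wq : weight (bar q) = c by rewrite -qc; apply: bar_weight.
have bt : bounded_table Y (initial_state m b).
  move=> p' r' x; rewrite inE => /eqP[-> _ ->].
  by rewrite big1 // => i _; rewrite ffunE.
have := enumerate_spec v b_gt0 b_le_c cY small_mul big_mul big_add m a_gt0 wq
  (leqnn c) (fun i => leq_bigmax i) bt.
rewrite /running_time; case: enumerate => x st' [_ _ _ clock'] /=.
apply: leq_trans (leq_trans (leq_addr _ _) clock') _.
rewrite add0n big_distrl /=; apply: leq_sum => i _.
rewrite /call_cost entry_iter_shift addn0 entry_ord -!mulnA leq_mul2l.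
rewrite [leqRHS]mulnC leq_mul2l.
have -> : \sum_(j < m | i <= j) p j = \sum_j iter i (@shift m) p j.
  by rewrite sum_iter_shift.
by rewrite (leq_trans (count_size _ _)) ?orbT // size_weighted_vecs.
Qed.

(** * Polynomial bounds for the sum over the levels *)

Lemma leq_expl x y e : x <= y -> x ^ e <= y ^ e.
Proof. by case: e => // e; rewrite leq_exp2r. Qed.

Lemma sum_bin_leq m (p : vec m) b :
  \sum_(i < m) 'C(p i + b - 1, b - 1) *
     'C((\sum_(j < m | i <= j) p j) + b - 1, b - 1) <=
  m * ((\max_i p i + b) ^ (b - 1) * (\sum_i p i + b) ^ (b - 1)).
Proof.
set X := (_ ^ _ * _ in leqRHS).
have -> : m * X = \sum_(i < m) X by rewrite sum_nat_const card_ord.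
apply: leq_sum => i _.
apply: leq_mul; apply: leq_trans (bin_leq_exp _ _) _; apply: leq_expl;
  apply: leq_trans (leq_subr _ _) _; rewrite leq_add2r ?leq_bigmax //.
by rewrite big_mkcond leq_sum // => j _; case: ifP.
Qed.

Lemma sum_leq_max n (q : vec n) : \sum_i q i <= n * \max_i q i.
Proof.
set M := \max_i q i.
have -> : n * M = \sum_(i < n) M by rewrite sum_nat_const card_ord.
by apply: leq_sum => i _; apply: leq_bigmax.
Qed.

(** Both [a] and [c] are at most [n * B]. The linear factor gives one [n] and each power gives
    [n ^ (b - 1)], so the exponent is [1 + 2 * (b - 1)]. *)
Lemma cost_bounded_b a b c n B m : 0 < n -> 0 < b <= B -> c <= n * b -> a <= c ->
  (a * b + c) * (m * ((a + b) ^ (b - 1) * (c + b) ^ (b - 1))) <=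
  B * B.+1 * (2 * B) ^ B * (2 * B) ^ B * (m * n ^ (2 * b - 1)).
Proof.
move=> n_gt0 /andP[b_gt0 bB] cn ac.
have cB : c <= n * B by rewrite (leq_trans cn) // leq_mul2l bB orbT.
have n_B : B <= n * B by rewrite leq_pmull.
have pow x : x <= n * B -> (x + b) ^ (b - 1) <= (2 * B) ^ B * n ^ (b - 1).
  move=> xn; apply: leq_trans (_ : (2 * B * n) ^ (b - 1) <= _).
    by apply: leq_expl; lia.
  rewrite expnMn leq_mul2r leq_pexp2l ?orbT //; first by lia.
  by rewrite (leq_trans (leq_subr _ _)).
have lin : a * b + c <= B * B.+1 * n.
  have : a * b <= n * B * B by rewrite leq_mul // (leq_trans ac).
  lia.
apply: leq_trans (leq_mul lin (leq_mul (leqnn m)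
  (leq_mul (pow _ (leq_trans ac cB)) (pow _ cB)))) _.
have -> : n ^ (2 * b - 1) = n * n ^ (b - 1) * n ^ (b - 1).
  by rewrite -expnS -expnD; congr (_ ^ _); lia.
by apply/eq_leq; ring.
Qed.

(** With [a] bounded, the power of [a + b] is a constant, which saves one factor [n ^ (b - 1)]. *)
Lemma cost_bounded_ab a b c n A B m :
  0 < n -> 0 < b <= B -> a <= A -> c <= n * b ->
  (a * b + c) * (m * ((a + b) ^ (b - 1) * (c + b) ^ (b - 1))) <=
  B * A.+1 * (A + B) ^ B * (2 * B) ^ B * (m * n ^ b).
Proof.
move=> n_gt0 /andP[b_gt0 bB] aA cn.
have cB : c <= n * B by rewrite (leq_trans cn) // leq_mul2l bB orbT.
have n_B : B <= n * B by rewrite leq_pmull.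
have pow : (c + b) ^ (b - 1) <= (2 * B) ^ B * n ^ (b - 1).
  apply: leq_trans (_ : (2 * B * n) ^ (b - 1) <= _).
    by apply: leq_expl; lia.
  rewrite expnMn leq_mul2r leq_pexp2l ?orbT //; first by lia.
  by rewrite (leq_trans (leq_subr _ _)).
have powA : (a + b) ^ (b - 1) <= (A + B) ^ B.
  apply: leq_trans (leq_expl _ (leq_add aA bB)) _.
  by rewrite leq_pexp2l ?(leq_trans (leq_subr _ _)) //; lia.
have lin : a * b + c <= B * A.+1 * n.
  have : a * b <= A * B by rewrite leq_mul.
  have : A * B <= A * (n * B) by rewrite leq_mul2l n_B orbT.
  lia.
apply: leq_trans (leq_mul lin (leq_mul (leqnn m) (leq_mul powA pow))) _.
have -> : n ^ b = n * n ^ (b - 1) by rewrite -expnS; congr (_ ^ _); lia.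
by apply/eq_leq; ring.
Qed.

Local Open Scope ring_scope.

(** * Logarithmic cost of the operations *)

Lemma ln_nat_gt0 (R : realType) n : (2 <= n)%N -> 0 < ln n%:R :> R.
Proof. by move=> n2; rewrite ln_gt0 // ltr1n. Qed.

Lemma ler_ln_nat (R : realType) x y : (0 < x <= y)%N -> ln x%:R <= ln y%:R :> R.
Proof.
case/andP=> x_gt0 xy; rewrite ler_ln ?posrE ?ltr0n ?ler_nat //.
exact: leq_trans xy.
Qed.

(** As [n >= 2], the constant [ln B] is at most [ln B / ln 2] times [ln n]. *)
Lemma ln_natM_leq (R : realType) B : (0 < B)%N ->
  exists2 K : R, 0 <= K & forall n, (2 <= n)%N -> ln (B * n)%:R <= K * ln n%:R.
Proof.
move=> B_gt0; have l2 : 0 < ln 2 :> R by apply: (ln_nat_gt0 R (n := 2)).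
have lB : 0 <= ln B%:R :> R by rewrite ln_ge0 // ler1n.
exists (ln B%:R / ln 2 + 1) => [|n n2].
  by rewrite addr_ge0 // divr_ge0 // ltW.
rewrite natrM lnM ?posrE ?ltr0n //; last exact: leq_trans n2.
rewrite mulrDl mul1r lerD2r -mulrA ler_peMr // ler_pdivlMl // mulr1.
exact: (ler_ln_nat R (x := 2)).
Qed.

(* The bound on [e] keeps the iterated logarithms of [N ^ e] in O(ln N). *)
Definition log_cube_cost (R : realType) (f : nat -> nat -> nat) : Prop :=
  exists2 K : R, 0 <= K & forall N e x y : nat,
    (2 <= N)%N -> (0 < e <= 4 * N)%N -> (x <= N ^ e)%N -> (y <= N ^ e)%N ->
    (f x y)%:R <= K * (e%:R * ln N%:R ^+ 3).

(** The hypothesis is applied with [k = N ^ (t * e)]: then [ln k] is linear in [e * ln N], and each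
    iterated logarithm contributes one more factor O(ln N). *)
Lemma log_cube_mul (R : realType) mulT :
  schonhage_strassen R mulT -> log_cube_cost R mulT.
Proof.
case=> C [k0 hC].
(* Above [expR (expR 1)] the double logarithm is at least 1 and the triple one nonnegative. The
   exponent [t] puts [k] beyond both [k0] and [k1], however small [N] and [e] are. *)
pose k1 := (Num.truncn (expR (expR 1 : R))).+1.
pose t := (k0 + k1)%N.+1.
have [K K_ge0 hK] := ln_natM_leq R (isT : (0 < 4 * t)%N) => //.
exists (`|C| * (t%:R * ((K + 1) * (K + 1))))
  => [|N e x y N2 /andP[e_gt0 eN] xN yN].
  by rewrite !mulr_ge0 // addr_ge0.
set L := ln N%:R; have L_gt0 : 0 < L by apply: ln_nat_gt0.
pose k := (N ^ (t * e))%N.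
have N_le_k : (N ^ e <= k)%N by rewrite leq_pexp2l ?leq_pmull // ltnW.
have t_lt_k : (t < k)%N.
  apply: leq_trans (ltn_expl _ N2) _.
  by rewrite leq_pexp2l ?leq_pmulr // ltnW.
have lnk : ln k%:R = t%:R * e%:R * L :> R.
  by rewrite natrX lnXn ?ltr0n ?(ltnW N2) // -[ln _ *+ _]mulr_natl natrM.
have expe_k : expR (expR 1) <= k%:R :> R.
  apply: le_trans (ltW (truncnS_gt _)) _; rewrite ler_nat.
  by rewrite (leq_trans _ (ltnW t_lt_k)) // /t /k1 -addSn leq_addl.
have k_gt0 : 0 < k%:R :> R by apply: lt_le_trans expe_k; apply: expR_gt0.
have lnk_ge : expR 1 <= ln k%:R :> R.
  by rewrite -[leLHS]expRK ler_ln ?posrE ?expR_gt0.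
have lnk_gt0 : 0 < ln k%:R :> R by apply: lt_le_trans lnk_ge; apply: expR_gt0.
have lnlnk_ge1 : 1 <= ln (ln k%:R) :> R.
  by rewrite -[leLHS]expRK ler_ln ?posrE ?expR_gt0.
have lnlnk_gt0 : 0 < ln (ln k%:R) :> R by apply: lt_le_trans lnlnk_ge1.
have lnlnlnk_ge0 : 0 <= ln (ln (ln k%:R)) :> R by apply: ln_ge0.
(* From [e <= 4 * N] and [ln N <= N] follows [ln k <= 4 * t * N * N]. *)
have lnlnk_le : ln (ln k%:R) <= (K + 1) * L.
  have N_gt0 : (0 < N)%N by apply: ltnW.
  apply: le_trans (_ : ln ((4 * t * N) * N)%:R <= _).
    rewrite ler_ln ?posrE // ?ltr0n ?muln_gt0 ?N_gt0 // lnk [leRHS]natrM.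
    apply: ler_pM; rewrite ?mulr_ge0 //; first exact: ltW.
      by rewrite -natrM ler_nat -[leqRHS]mulnA [leqRHS]mulnCA leq_mul2l eN orbT.
    by apply/ltW/ln_sublinear; rewrite ltr0n.
  rewrite natrM lnM ?posrE ?ltr0n ?muln_gt0 ?N_gt0 // mulrDl mul1r lerD2r.
  exact: hK.
have lnlnlnk_le : ln (ln (ln k%:R)) <= (K + 1) * L.
  by apply: le_trans (ltW (ln_sublinear lnlnk_gt0)) lnlnk_le.
have k0k : (k0 <= k)%N.
  by rewrite (leq_trans _ (ltnW t_lt_k)) // /t -addnS leq_addr.
apply: le_trans (hC _ _ _ k0k (leq_trans xN N_le_k) (leq_trans yN N_le_k)) _.
apply: le_trans (ler_norm _) _; rewrite normrM -!mulrA ler_wpM2l //.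
rewrite ger0_norm; last by rewrite !mulr_ge0 // ltW.
have prod_le : ln (ln k%:R) * ln (ln (ln k%:R)) <= (K + 1) * L * ((K + 1) * L).
  by apply: ler_pM; rewrite // ltW.
apply: le_trans (ler_wpM2l (ltW lnk_gt0) prod_le) _.
rewrite lnk le_eqVlt; apply/orP; left; apply/eqP; ring.
Qed.

Lemma log_cube_add (R : realType) addT :
  linear_addition R addT -> log_cube_cost R addT.
Proof.
case=> C [k0 hC]; pose t := k0.+1.
have l2 : 0 < ln 2 :> R by apply: (ln_nat_gt0 R (n := 2)).
exists (`|C| * (t%:R / ln 2 ^+ 2)) => [|N e x y N2 /andP[e_gt0 eN] xN yN].
  by rewrite mulr_ge0 // divr_ge0 // exprn_ge0 // ltW.
set L := ln N%:R; have L_gt0 : 0 < L by apply: ln_nat_gt0.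
have L2 : ln 2 <= L by apply: (ler_ln_nat R (x := 2)).
pose k := (N ^ (t * e))%N.
have N_le_k : (N ^ e <= k)%N by rewrite leq_pexp2l ?leq_pmull // ltnW.
have k0k : (k0 <= k)%N.
  apply/ltnW/(leq_trans (ltnW (ltn_expl t N2))).
  by rewrite leq_pexp2l ?leq_pmulr // ltnW.
have lnk : ln k%:R = t%:R * e%:R * L :> R.
  by rewrite natrX lnXn ?ltr0n ?(ltnW N2) // -[ln _ *+ _]mulr_natl natrM.
apply: le_trans (hC _ _ _ k0k (leq_trans xN N_le_k) (leq_trans yN N_le_k)) _.
apply: le_trans (ler_norm _) _; rewrite normrM -!mulrA ler_wpM2l // lnk.
have te_ge0 : 0 <= t%:R * e%:R :> R by rewrite mulr_ge0.
rewrite ger0_norm; last by rewrite !mulr_ge0 // ltW.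
(* Addition costs only one logarithm; it is padded to a cube by the factor
   [(L / ln 2) ^+ 2 >= 1]. *)
rewrite [leRHS](_ : _ = t%:R * e%:R * (L * (L / ln 2) ^+ 2)); last first.
  by field; rewrite gt_eqF.
rewrite ler_wpM2l //; apply: ler_peMr; first exact: ltW.
by apply: exprn_ege1; rewrite ler_pdivlMr // mul1r.
Qed.

(** Taken with [Y = 2 * N], which is at most [N ^ 2], so that the operands are at most [N ^ (2 * a)]
    and [N ^ (4 * c)]. Keeping [N] apart from [c] allows both [N = c] and [N] a multiple of [n]. *)
Lemma running_time_log_cube (R : realType) mulT addT v :
  log_cube_cost R mulT -> log_cube_cost R addT ->
  exists2 K : R, 0 <= K & forall m n N (p : vec m) (q : vec n),
    let c := (\sum_i p i)%N in
    let a := (\max_i p i)%N in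
    let b := (\max_i q i)%N in
    (\sum_i q i = c)%N -> (2 <= N)%N -> (c <= N)%N ->
    (running_time mulT addT v p q)%:R <=
      K * ((a * b + c)%:R * ln N%:R ^+ 3 *
        (\sum_(i < m) 'C(p i + b - 1, b - 1) *
           'C((\sum_(j < m | i <= j) p j) + b - 1, b - 1))%N%:R).
Proof.
case=> K1 K1_ge0 hK1 [K2 K2_ge0 hK2].
have K_ge0 : 0 <= K1 + K2 by apply: addr_ge0.
exists (8 * (K1 + K2)) => [|m n N p q c a b qc N2 cN]; first exact: mulr_ge0.
have L_gt0 := ln_nat_gt0 R N2; set L := ln N%:R in L_gt0 *.
have L3_ge0 : 0 <= L ^+ 3 by rewrite exprn_ge0 // ltW.
have [c0|c_gt0] := posnP c.
  rewrite running_time0 ?qc //; do 2![apply: mulr_ge0 => //].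
  exact: mulr_ge0.
have ac : (a <= c)%N by apply: max_leq_sum.
have a_gt0 : (0 < a)%N by apply: max_gt0.
set Y := (N + N)%N.
have YN e : (Y ^ e <= N ^ (2 * e))%N.
  by rewrite expnM leq_expl // /Y addnn -mul2n -mulnn leq_mul2r N2 orbT.
have YYN e : ((Y * Y) ^ e <= N ^ (4 * e))%N.
  by rewrite mulnn -expnM -[4%N]/(2 * 2)%N -mulnA YN.
have T_ge0 e : 0 <= (K1 + K2) * (e%:R * L ^+ 3).
  by do 2![apply: mulr_ge0 => //].
(* Operation counts are natural numbers, so truncating the real bound loses nothing. *)
pose T e := Num.truncn ((K1 + K2) * (e%:R * L ^+ 3)).
have costT (f : nat -> nat -> nat) e x y (K : R) :
    K <= K1 + K2 -> (f x y)%:R <= K * (e%:R * L ^+ 3) ->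
    (f x y <= T e)%N.
  move=> KK fK; rewrite truncn_ge_nat // (le_trans fK) //.
  by rewrite ler_wpM2r // mulr_ge0.
have K1K : K1 <= K1 + K2 by rewrite lerDl.
have K2K : K2 <= K1 + K2 by rewrite lerDr.
set S := (\sum_(i < m) _)%N.
have rt_le : (running_time mulT addT v p q <=
    S * (b * T (2 * a) + T (4 * c) + T (4 * c)))%N.
  apply: (running_time_leq v c_gt0 qc (leq_add cN cN)) => x y xY yY.
  - apply: (costT _ (2 * a)%N _ _ _ K1K).
    apply: (hK1 N) => //; first by lia.
    + exact: leq_trans xY (YN a).
    + exact: leq_trans yY (YN a).
  - apply: (costT _ (4 * c)%N _ _ _ K1K).
    apply: (hK1 N) => //; first by lia.
    + exact: leq_trans xY (YYN c).
    + exact: leq_trans yY (YYN c).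
  - apply: (costT _ (4 * c)%N _ _ _ K2K).
    apply: (hK2 N) => //; first by lia.
    + exact: leq_trans xY (YYN c).
    + exact: leq_trans yY (YYN c).
move: rt_le; rewrite -(ler_nat R) => /le_trans; apply.
rewrite natrM mulrC [leRHS]mulrA ler_wpM2r //.
have T_le e : (T e)%:R <= (K1 + K2) * (e%:R * L ^+ 3) by rewrite truncn_le.
rewrite !natrD (natrM _ b).
(* The cost per summand is [2ab + 4c + 4c], hence the constant 8; the last term is the slack
   [6ab]. *)
have -> : 8 * (K1 + K2) * (((a * b)%:R + c%:R) * L ^+ 3) =
  b%:R * ((K1 + K2) * ((2 * a)%:R * L ^+ 3))
  + (K1 + K2) * ((4 * c)%:R * L ^+ 3) + (K1 + K2) * ((4 * c)%:R * L ^+ 3)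
  + 6 * (b%:R * ((K1 + K2) * (a%:R * L ^+ 3))).
  by rewrite !natrM; ring.
apply: ler_wpDr; first by do 4![apply: mulr_ge0 => //].
by rewrite !lerD // ler_wpM2l.
Qed.

(** Replaces the logarithm of [B * n] by that of [n], absorbing the cube of the ratio and the factor
    [D] into the constant. *)
Lemma cost_ln_mul_leq (R : realType) (K : R) B D : 0 <= K -> (0 < B)%N ->
  exists K' : R, 0 <= K' /\
    forall n X S Z : nat, (2 <= n)%N -> (X * S <= D * Z)%N ->
      K * (X%:R * ln (B * n)%:R ^+ 3 * S%:R) <= K' * (Z%:R * ln n%:R ^+ 3).
Proof.
move=> K_ge0 B_gt0; have [k k_ge0 hk] := ln_natM_leq R B_gt0.
exists (K * (D%:R * k ^+ 3)); split=> [|n X S Z n2 XSZ].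
  by rewrite !mulr_ge0 // exprn_ge0.
have n_gt0 : (0 < n)%N by apply: ltnW.
have lB_ge0 : 0 <= ln (B * n)%:R :> R.
  by rewrite ln_ge0 // ler1n muln_gt0 B_gt0.
rewrite -[leRHS]mulrA ler_wpM2l //.
rewrite [leRHS](_ : _ = (D * Z)%:R * (k * ln n%:R) ^+ 3); last first.
  by rewrite natrM; ring.
rewrite mulrAC -natrM; apply: ler_pM => //; first exact: exprn_ge0.
  by rewrite ler_nat.
by rewrite lerXn2r ?nnegrE // ?hk // (le_trans lB_ge0) ?hk.
Qed.

(** * Derivation of the four bounds *)

Theorem theorem2p3 (R : realType) (mulT addT : nat -> nat -> nat)
    (hmul : schonhage_strassen R mulT) (hadd : linear_addition R addT)
    (v : entries) :
  [/\ exists K : R, forall (m n c : nat) (p : vec m) (q : vec n),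
        (\sum_i p i = c)%N -> (\sum_i q i = c)%N -> (2 <= c)%N ->
        let a := (\max_i p i)%N in
        let b := (\max_i q i)%N in
        (running_time mulT addT v p q)%:R <=
          K * ((a * b + c)%:R * ln c%:R ^+ 3 *
            (\sum_(i < m) 'C(p i + b - 1, b - 1) *
               'C((\sum_(j < m | i <= j) p j) + b - 1, b - 1))%N%:R),
      exists K : R, forall (m n c : nat) (p : vec m) (q : vec n),
        (\sum_i p i = c)%N -> (\sum_i q i = c)%N -> (2 <= c)%N ->
        let a := (\max_i p i)%N in
        let b := (\max_i q i)%N in
        (running_time mulT addT v p q)%:R <=
          K * (m%:R * (a * b + c)%:R * (a + b)%:R ^+ (b - 1) *
            (b + c)%:R ^+ (b - 1) * ln c%:R ^+ 3),
      forall B : nat,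
      exists K : R, forall (m n : nat) (p : vec m) (q : vec n),
        (\sum_i p i = \sum_i q i)%N -> (2 <= n)%N ->
        let b := (\max_i q i)%N in
        (b <= B)%N ->
        (running_time mulT addT v p q)%:R <=
          K * (m%:R * n%:R ^ (2%:Z * b%:Z - 1) * ln n%:R ^+ 3) &
      forall A B : nat,
      exists K : R, forall (m n : nat) (p : vec m) (q : vec n),
        (\sum_i p i = \sum_i q i)%N -> (2 <= n)%N ->
        let a := (\max_i p i)%N in
        let b := (\max_i q i)%N in
        (a <= A)%N -> (b <= B)%N ->
        (running_time mulT addT v p q)%:R <=
          K * (m%:R * n%:R ^+ b * ln n%:R ^+ 3)].
Proof.
have [K K_ge0 hK] :=
  running_time_log_cube v (log_cube_mul hmul) (log_cube_add hadd).
have hS m n N (p : vec m) (q : vec n) :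
    let c := (\sum_i p i)%N in
    let a := (\max_i p i)%N in
    let b := (\max_i q i)%N in
    (\sum_i q i = c)%N -> (2 <= N)%N -> (c <= N)%N ->
    (running_time mulT addT v p q)%:R <=
      K * ((a * b + c)%:R * ln N%:R ^+ 3 *
        (m * ((a + b) ^ (b - 1) * (c + b) ^ (b - 1)))%N%:R).
  move=> c a b qc N2 cN; apply: le_trans (hK _ _ _ _ _ qc N2 cN) _.
  rewrite !ler_wpM2l // ?ler_nat ?sum_bin_leq // mulr_ge0 // exprn_ge0 //.
  by rewrite ltW // ln_nat_gt0.
split.
- by exists K => m n c p q <- qc c2; apply: hK.
- exists K => m n c p q <- qc c2 /=.
  apply: le_trans (hS _ _ _ _ _ qc c2 (leqnn _)) _.
 
  apply: ler_wpM2l => //; rewrite le_eqVlt; apply/orP; left; apply/eqP.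
  by rewrite !natrM !natrX [(\sum_i p i + _)%N]addnC; ring.
(* [B = 0] forces [q = 0], where the running time is 0. *)
- move=> B; have [-> | B_gt0] := posnP B.
    exists 0 => m n p q pq n2 b; rewrite leqn0 => /eqP b0.
    have q0 : (\sum_i q i = 0)%N.
      by apply/eqP; rewrite -leqn0 (leq_trans (sum_leq_max q)) // -/b b0 muln0.
    by rewrite running_time0 ?mul0r // pq.
  have [K' [K'_ge0 hK']] :=
    cost_ln_mul_leq (B * B.+1 * (2 * B) ^ B * (2 * B) ^ B) K_ge0 B_gt0.
  exists K' => m n p q pq n2 b bB; have n_gt0 : (0 < n)%N by apply: ltnW.
  (* For [q = 0] the integer exponent is -1; once [b > 0] it is the natural number [2 * b - 1]. *)
  have [c0|c_gt0] := posnP (\sum_i q i)%N.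
    have L3_ge0 : 0 <= ln n%:R ^+ 3 :> R.
      by rewrite exprn_ge0 // ltW // ln_nat_gt0.
    rewrite running_time0 ?pq //; do 2![apply: mulr_ge0 => //].
    by apply: mulr_ge0 => //; apply: exprz_ge0.
  have b_gt0 : (0 < b)%N by apply: max_gt0.
  have cn : (\sum_i p i <= n * b)%N by rewrite pq sum_leq_max.
  have -> : n%:R ^ (2%:Z * b%:Z - 1) = (n ^ (2 * b - 1))%N%:R :> R.
    have -> : 2%:Z * b%:Z - 1 = (2 * b - 1)%N by lia.
    by rewrite -exprnP natrX.
  (* The choice [N = B * n] is admissible, as [c <= n * b <= B * n]. *)
  rewrite -natrM; apply: le_trans (hS _ _ (B * n)%N _ _ (esym pq) _ _) _.
  + by rewrite (leq_trans n2) // leq_pmull.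
  + by rewrite (leq_trans cn) // mulnC leq_mul2r bB orbT.
  + by apply: hK' => //; apply: cost_bounded_b; rewrite ?b_gt0 // max_leq_sum.
- move=> A B; have [-> | B_gt0] := posnP B.
    exists 0 => m n p q pq n2 a b _; rewrite leqn0 => /eqP b0.
    have q0 : (\sum_i q i = 0)%N.
      by apply/eqP; rewrite -leqn0 (leq_trans (sum_leq_max q)) // -/b b0 muln0.
    by rewrite running_time0 ?mul0r // pq.
  have [K' [K'_ge0 hK']] :=
    cost_ln_mul_leq (B * A.+1 * (A + B) ^ B * (2 * B) ^ B) K_ge0 B_gt0.
  exists K' => m n p q pq n2 a b aA bB; have n_gt0 : (0 < n)%N by apply: ltnW.
  have [c0|c_gt0] := posnP (\sum_i q i)%N.
    rewrite running_time0 ?pq //; apply: mulr_ge0 => //.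
    by rewrite !mulr_ge0 ?exprn_ge0 // ltW // ln_nat_gt0.
  have b_gt0 : (0 < b)%N by apply: max_gt0.
  have cn : (\sum_i p i <= n * b)%N by rewrite pq sum_leq_max.
  rewrite -natrX -natrM; apply: le_trans (hS _ _ (B * n)%N _ _ (esym pq) _ _) _.
  + by rewrite (leq_trans n2) // leq_pmull.
  + by rewrite (leq_trans cn) // mulnC leq_mul2r bB orbT.
  + by apply: hK' => //; apply: cost_bounded_ab; rewrite ?b_gt0.
Qed.
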